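(* Let $1\le n\le m$ be integers, let $u_0,u_1,\dots,u_m$ be a sequence of (compact, nonempty) real intervals with $u_m=[0,0]$, and let $\lambda_1,\lambda_2\ge 1$ be such that the interval powers $u_i^{\lambda_1}$ and $(\nabla u_i)^{\lambda_2}$ are defined for $n\le i\le m-1$. If $\{u_i\}_{i=0}^m$ is piecewise alternate monotone and piecewise alternate $\mu$-monotone, and $u_i\neq[0,0]$ for every $n\le i\le m-1$, then $$\sum_{i=n}^{m-1}\Big\|u_i^{\lambda_1}\cdot(\nabla u_i)^{\lambda_2}\Big\|\le \frac{\lambda_2(m-n+1)^{\lambda_1}}{\lambda_1+\lambda_2}\sum_{i=n}^{m}\|\nabla u_i\|^{\lambda_1+\lambda_2}.$$
   Context: An interval is $u=[\underline{u},\overline{u}]=\{t\in\mathbb{R}:\underline{u}\le t\le\overline{u}\}$ with $\underline u\le\overline u$ real; $len(u)=\overline u-\underline u$. Product: $u\cdot v=[\min S,\max S]$ with $S=\{\underline u\,\underline v,\ \underline u\,\overline v,\ \overline u\,\underline v,\ \overline u\,\overline v\}$. gH-difference: $u\ominus_g v=[\min\{\underline u-\underline v,\overline u-\overline v\},\max\{\underline u-\underline v,\overline u-\overline v\}]$. Backward gH-difference operator: $\nabla u_i=u_i\ominus_g u_{i-1}$. Quasi-norm: $\|u\|=\max\{|\underline u|,|\overline u|\}$. Power: $u^{\lambda}=\{t^{\lambda}:t\in u\}$, considered when $t^\lambda$ is defined for all $t\in u$: $\lambda\ge1$ may be any real number if $u\subseteq[0,\infty)$, while $\lambda$ is a positive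 integer if $u$ contains negative numbers. A sequence $(u_i)$ of intervals is increasing (decreasing) if both real sequences $(\underline{u_i})$ and $(\overline{u_i})$ are increasing (decreasing), in the weak sense. It is $\mu$-increasing ($\mu$-decreasing) if $(len(u_i))$ is increasing (decreasing), weakly. A finite sequence $\{u_i\}_{i=a}^{b}$ is piecewise alternate monotone if there are indices $a=i_0<i_1<\dots<i_k=b$ ($k\ge0$) such that on each block $\{i_{j-1},\dots,i_j\}$ the sequence is increasing or decreasing, with the direction alternating from one block to the next; piecewise alternate $\mu$-monotone is defined in the same way with $\mu$-increasing/$\mu$-decreasing in place of increasing/decreasing. An empty sum is $0$. *)

(* Defs.v *)
From HB Require Import structures.
From mathcomp Require Export all_boot all_order all_algebra.
From mathcomp Require Export all_classical all_reals all_analysis.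
Set Implicit Arguments.
Unset Strict Implicit.
Unset Printing Implicit Defensive.
Import Order.TTheory GRing.Theory Num.Theory.
Import numFieldNormedType.Exports.
Local Open Scope classical_set_scope.
Local Open Scope ring_scope.

(* Nonempty compact intervals, whereas [interval R] also has empty,
   open and unbounded intervals. *)
Record cinterval (R : realType) : Type := CInterval {
  lo : R;
  hi : R;
  lo_le_hi : lo <= hi
}.

HB.instance Definition _ (R : realType) := gen_eqMixin (cinterval R).
HB.instance Definition _ (R : realType) := gen_choiceMixin (cinterval R).

Section IntervalArithmetic.
Context {R : realType}.
Implicit Types (u v : cinterval R) (x t : R).

Definition iset u : set R := [set t | lo u <= t <= hi u].

Lemma iset_inj : injective iset.
Proof.
move=> [a b ab] [c d cd]; rewrite /iset /= => /seteqP[h1 h2].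
have /andP[ca _] : c <= a <= d by apply: h1; rewrite /= lexx.
have /andP[_ bd] : c <= b <= d by apply: h1; rewrite /= lexx andbT.
have /andP[ac _] : a <= c <= b by apply: h2; rewrite /= lexx.
have /andP[_ db] : a <= d <= b by apply: h2; rewrite /= lexx andbT.
have ? : a = c by apply/le_anti/andP.
have ? : b = d by apply/le_anti/andP.
by subst; congr CInterval; exact: bool_irrelevance.
Qed.

Definition ipoint x : cinterval R := CInterval (lexx x).

Definition ilen u : R := hi u - lo u.

Definition inorm u : R := Num.max `|lo u| `|hi u|.

Lemma le_min_max x y : Num.min x y <= Num.max x y.
Proof. by rewrite ge_min le_max lexx. Qed.

Definition igHsub u v : cinterval R :=
  CInterval (le_min_max (lo u - lo v) (hi u - hi v)).

Lemma imul_subproof (a b c d : R) :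
  Num.min (Num.min a b) (Num.min c d) <= Num.max (Num.max a b) (Num.max c d).
Proof. by rewrite !ge_min !le_max lexx. Qed.

Definition imul u v : cinterval R :=
  CInterval (imul_subproof (lo u * lo v) (lo u * hi v)
                           (hi u * lo v) (hi u * hi v)).

(* Library [powR] is the real power only for a nonnegative base; a negative
   base is used only with a natural exponent, recovered by [truncn]. *)
Definition rpow t (l : R) : R := if 0 <= t then t `^ l else t ^+ Num.truncn l.

Definition ipow_defined u (l : R) : Prop :=
  iset u `<=` [set t | 0 <= t] \/ exists k : nat, (0 < k)%N /\ l = k%:R.

(* The default value is never used when [ipow_defined u l] and [1 <= l]: see
   [iset_ipow]. *)
Definition ipow u (l : R) : cinterval R :=
  xget (ipoint 0) [set v | iset v = [set rpow t l | t in iset u]].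

Lemma rpow_nat t k : rpow t k%:R = t ^+ k.
Proof. by rewrite /rpow; case: ifPn => [/powR_mulrn //|_]; rewrite natrK. Qed.

Lemma iset_ipow u (l : R) : 1 <= l -> ipow_defined u l ->
  iset (ipow u l) = [set rpow t l | t in iset u].
Proof.
move=> l1 ud.
suff: exists v, iset v = [set rpow t l | t in iset u].
  by rewrite /ipow => ex; exact: (xgetPex (ipoint 0) ex).
have l0 : 0 < l by rewrite (lt_le_trans _ l1).
have uu := lo_le_hi u.
case: ud => [u0|[k [k0 lk]]].
- have lo0 : 0 <= lo u by apply: u0; rewrite /iset /= lexx.
  have hi0 : 0 <= hi u := le_trans lo0 uu.
  have mono x y (r : R) : 0 <= r -> 0 <= x -> x <= y -> x `^ r <= y `^ r.
    move=> r0 x0 xy; apply: ge0_ler_powR; rewrite ?nnegrE//.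
    exact: le_trans xy.
  exists (CInterval (mono _ _ _ (ltW l0) lo0 uu)).
  rewrite /iset; apply/seteqP; split => y /=.
  + move=> /andP[ly yh].
    have y0 : 0 <= y := le_trans (powR_ge0 _ _) ly.
    have V0 : 0 <= l^-1 by rewrite invr_ge0 ltW.
    have root x : 0 <= x -> (x `^ l) `^ l^-1 = x.
      by move=> x0; rewrite -powRrM divff ?gt_eqF// powRr1.
    exists (y `^ l^-1).
      apply/andP; split.
        by rewrite -[leLHS]root//; apply: mono => //; exact: powR_ge0.
      by rewrite -[leRHS]root//; exact: mono.
    by rewrite /rpow powR_ge0 -powRrM mulVf ?gt_eqF// powRr1.
  + move=> [t /andP[lt th] <-].
    have t0 := le_trans lo0 lt.
    by rewrite /rpow t0 !mono// ltW.
- pose f t : R := t ^+ k.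
  have cf : continuous f by move=> ?; exact: exprn_continuous.
  have cw : {within `[lo u, hi u], continuous f}.
    exact: continuous_subspaceT.
  have [c cI cM] := EVT_min uu cw.
  have [d dI dM] := EVT_max uu cw.
  exists (CInterval (cM _ dI)); rewrite /iset; apply/seteqP; split => y /=.
  + move=> yI.
    have [e eI <-] : exists2 e, e \in `[Num.min c d, Num.max c d] & f e = y.
      apply: IVT; first exact: le_min_max.
        exact: continuous_subspaceT.
      have /andP[h1 h2] := yI.
      case: (leP c d) => _; first by rewrite ge_min le_max h1 h2 orbT.
      by rewrite ge_min le_max h1 h2 orbT.
    exists e; last by rewrite lk rpow_nat.
    move: eI cI dI; rewrite !in_itv /= ge_min le_max.
    case/andP=> /orP[h1|h1] /orP[h2|h2] /andP[h3 h4] /andP[h5 h6];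
      by apply/andP; split; [apply: le_trans h1|apply: le_trans h2 _].
  + move=> [t tI <-]; rewrite lk rpow_nat.
    have tI' : t \in `[lo u, hi u] by rewrite in_itv.
    by rewrite cM// dM.
Qed.

End IntervalArithmetic.

Section IntervalSequences.
Context {R : realType}.
Implicit Types (f : nat -> R) (u : nat -> cinterval R) (a b : nat).

(* Meaningful only for [0 < i]. *)
Definition nabla u (i : nat) : cinterval R := igHsub (u i) (u i.-1).

Definition increasing_on f a b : Prop :=
  forall i j, (a <= i)%N -> (i <= j)%N -> (j <= b)%N -> f i <= f j.

Definition decreasing_on f a b : Prop :=
  forall i j, (a <= i)%N -> (i <= j)%N -> (j <= b)%N -> f j <= f i.

Definition iincreasing_on u a b : Prop :=
  increasing_on (fun i => lo (u i)) a b /\ increasing_on (fun i => hi (u i)) a b.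

Definition idecreasing_on u a b : Prop :=
  decreasing_on (fun i => lo (u i)) a b /\ decreasing_on (fun i => hi (u i)) a b.

Definition mu_increasing_on u a b : Prop :=
  increasing_on (fun i => ilen (u i)) a b.

Definition mu_decreasing_on u a b : Prop :=
  decreasing_on (fun i => ilen (u i)) a b.

(* [up] is the direction of the first block. *)
Definition piecewise_alternate (inc dec : nat -> nat -> Prop) a b : Prop :=
  exists (k : nat) (p : nat -> nat) (up : bool),
    [/\ p 0%N = a, p k = b, (forall j, (j < k)%N -> (p j < p j.+1)%N)
      & forall j, (j < k)%N ->
          if up (+) odd j then inc (p j) (p j.+1) else dec (p j) (p j.+1)].

Definition piecewise_alternate_monotone u a b : Prop :=
  piecewise_alternate (iincreasing_on u) (idecreasing_on u) a b.

Definition piecewise_alternate_mu_monotone u a b : Prop :=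
  piecewise_alternate (mu_increasing_on u) (mu_decreasing_on u) a b.

End IntervalSequences.

(* Main.v *)
Require Import Defs.
From mathcomp Require Import all_boot all_order all_algebra.
From mathcomp Require Import all_classical all_reals all_analysis.
From mathcomp Require Import ring lra.
Import Order.TTheory GRing.Theory Num.Theory.
Import numFieldNormedType.Exports.
Local Open Scope ring_scope.

(** The quasi-norm turns the interval inequality into a scalar one. It is
    submultiplicative, it commutes with powers, and on endpoints it is the
    sup norm of the plane, for which the gH-difference is an ordinary
    difference: hence [inorm (u i) <= inorm (u i.+1) + inorm (nabla u i.+1)]
    ([inorm_le_igHsub]). As [u m] is zero, [inorm (u i)] is at most the sum of
    the [inorm (nabla u j)] for [i < j <= m].

    Counting down from [m], what remains is a discrete Opial inequality
    ([discrete_opial]): if [y k >= 0] and [b k] is at most the sum of the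
    [y j] for [j < k], then the sum of [b k `^ p * y k `^ q] over [k < N] is
    at most [q * N `^ p / (p + q)] times the sum [S] of the [y k `^ (p + q)].
    It follows by induction on [N]. With [M] the mean of [y 0, ..., y (N - 1)],
    the new term is at most [N `^ p * (M `^ p * y N `^ q)]; Young's inequality
    separates [M] from [y N], and Jensen's inequality bounds [M `^ (p + q)] by
    [S / N]. The coefficient of [S] becomes
    [(q * N `^ p + p * N `^ (p - 1)) / (p + q)], which is at most
    [q * (N + 1) `^ p / (p + q)] because [q >= 1] and, by convexity,
    [N `^ p + p * N `^ (p - 1) <= (N + 1) `^ p]. Jensen and this last bound
    both come from the tangent line inequality for [powR], itself an instance
    of Young's inequality. *)

(** * Power inequalities *)

(** The case [a = 0] is an equality; otherwise this is the conjugate exponent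
    inequality for [x `^ a] and [y `^ b]. Allowing [a = 0] lets
    [powR_tangent] cover [p = 1]. *)
Lemma powR_young {R : realType} (x y a b : R) :
  0 <= x -> 0 <= y -> 0 <= a -> 0 < b ->
  x `^ a * y `^ b <= (a * x `^ (a + b) + b * y `^ (a + b)) / (a + b).
Proof.
move=> x0 y0; rewrite le_eqVlt => /predU1P[<- b0|a0 b0].
  by rewrite powRr0 !add0r mul0r mul1r add0r mulrAC divff ?gt_eqF// mul1r.
have ab0 : 0 < a + b by rewrite addr_gt0.
have aN0 : a != 0 by rewrite gt_eqF.
have bN0 : b != 0 by rewrite gt_eqF.
have abN0 : a + b != 0 by rewrite gt_eqF.
have := @conjugate_powR R (x `^ a) (y `^ b) ((a + b) / a) ((a + b) / b).
rewrite !powR_ge0 !divr_gt0// -!powRrM.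
have -> : a * ((a + b) / a) = a + b by field.
have -> : b * ((a + b) / b) = a + b by field.
move=> /(_ erefl erefl erefl erefl) H.
apply: (le_trans (H _)); first by field; rewrite aN0 bN0 abN0.
by rewrite le_eqVlt; apply/orP; left; apply/eqP; field; rewrite aN0 bN0 abN0.
Qed.

(** This is Young's inequality for [s `^ (p - 1) * t], rearranged. *)
Lemma powR_tangent {R : realType} (s t p : R) : 0 <= s -> 0 <= t -> 1 <= p ->
  s `^ p + p * s `^ (p - 1) * (t - s) <= t `^ p.
Proof.
move=> s0 t0 p1; have p0 : 0 < p by lra.
have := @powR_young R s t (p - 1) 1 s0 t0.
rewrite subr_ge0 p1 => /(_ erefl ltr01).
rewrite powRr1// subrK ler_pdivlMr// mul1r => H.
have E := mulr_powRB1 s0 p0.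
have -> : p * s `^ (p - 1) * (t - s)
    = s `^ (p - 1) * t * p - p * (s * s `^ (p - 1)) by ring.
rewrite E; lra.
Qed.

(** The tangent lines at the mean have slopes that cancel in the sum. *)
Lemma powR_mean_le {R : realType} (N : nat) (y : nat -> R) (r : R) :
  (0 < N)%N -> (forall k, 0 <= y k) -> 1 <= r ->
  ((\sum_(k < N) y k) / N%:R) `^ r <= (\sum_(k < N) y k `^ r) / N%:R.
Proof.
move=> N0 y0 r1; set s := _ / _.
have N0' : 0 < N%:R :> R by rewrite ltr0n.
have s0 : 0 <= s by rewrite divr_ge0 ?sumr_ge0.
rewrite ler_pdivlMr//.
have -> : s `^ r * N%:R
    = \sum_(k < N) (s `^ r + r * s `^ (r - 1) * (y k - s)).
  rewrite big_split /= -mulr_sumr sumrB !sumr_const card_ord.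
  rewrite -[s `^ r *+ N]mulr_natr -[s *+ N]mulr_natr.
  by rewrite [s * _]divfK ?gt_eqF// subrr mulr0 addr0.
by apply: ler_sum => k _; exact: powR_tangent.
Qed.

(** * The discrete Opial inequality *)

Lemma discrete_opial {R : realType} (N : nat) (b y : nat -> R) (p q : R) :
  1 <= p -> 1 <= q ->
  (forall k, 0 <= b k) -> (forall k, 0 <= y k) ->
  (forall k, (k < N)%N -> b k <= \sum_(j < k) y j) ->
  \sum_(k < N) b k `^ p * y k `^ q
    <= q * N%:R `^ p / (p + q) * \sum_(k < N) y k `^ (p + q).
Proof.
move=> p1 q1 b0 y0; have p0 : 0 < p by lra.
have q0 : 0 < q by lra.
have pq0 : 0 < p + q by lra.
elim: N => [|N IH] b_le; first by rewrite !big_ord0 mulr0.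
rewrite !big_ord_recr /=.
set S := \sum_(k < N) y k `^ (p + q).
have S0 : 0 <= S by apply: sumr_ge0 => k _; exact: powR_ge0.
have yq0 : 0 <= y N `^ (p + q) by exact: powR_ge0.
have {}IH : \sum_(k < N) b k `^ p * y k `^ q <= q * N%:R `^ p / (p + q) * S.
  by apply: IH => k kN; apply: b_le; rewrite ltnS ltnW.
have {b_le} := b_le N (ltnSn N).
case: (posnP N) => [N_eq0|N0] b_le.
  (* An empty sum bounds [b 0], so the only term vanishes. *)
  subst N; move: b_le; rewrite big_ord0 => b_le.
  have -> : b 0%N = 0 by apply/le_anti; rewrite b_le b0.
  rewrite big_ord0 powR0 ?gt_eqF// mul0r addr0 mulr_ge0 ?addr_ge0//.
  by rewrite divr_ge0 ?mulr_ge0 ?powR_ge0 ?ltW.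
have N0' : 0 < N%:R :> R by rewrite ltr0n.
pose M := (\sum_(j < N) y j) / N%:R.
have M0 : 0 <= M by rewrite divr_ge0 ?sumr_ge0.
have last_le : b N `^ p * y N `^ q <= N%:R `^ p * (M `^ p * y N `^ q).
  rewrite mulrA -powRM ?ler0n// ler_wpM2r ?powR_ge0//.
  have -> : N%:R * M = \sum_(j < N) y j by rewrite mulrC divfK ?gt_eqF.
  by apply: ge0_ler_powR => //; rewrite ?nnegrE ?sumr_ge0// ltW.
have young := @powR_young R M (y N) p q M0 (y0 N) (ltW p0) q0.
have jensen : M `^ (p + q) <= S / N%:R by apply: powR_mean_le => //; lra.
have bernoulli : N%:R `^ p + p * N%:R `^ (p - 1) <= N.+1%:R `^ p :> R.
  have := @powR_tangent R N%:R N.+1%:R p (ler0n _ _) (ler0n _ _) p1.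
  by rewrite -[in N.+1%:R - _]natr1 addrAC subrr add0r mulr1.
have NpE := @mulr_powRB1 R N%:R p (ltW N0') p0.
set A := N%:R `^ p in IH last_le bernoulli NpE *.
set B := N%:R `^ (p - 1) in bernoulli NpE *.
set C := N.+1%:R `^ p in bernoulli *.
have A0 : 0 <= A by exact: powR_ge0.
have B0 : 0 <= B by exact: powR_ge0.
have new_le : b N `^ p * y N `^ q <= (p * B * S + q * A * y N `^ (p + q)) / (p + q).
  apply: (le_trans last_le).
  apply: (le_trans (ler_wpM2l A0 young)).
  rewrite mulrA ler_pM2r ?invr_gt0// mulrDr.
  have -> : p * B * S = A * (p * (S / N%:R)).
    by rewrite -NpE; field; rewrite gt_eqF.
  rewrite (mulrC q A) -(mulrA A q) lerD2r ler_wpM2l// ler_wpM2l//; exact: ltW.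
apply: (le_trans (lerD IH new_le)).
have -> : q * A / (p + q) * S + (p * B * S + q * A * y N `^ (p + q)) / (p + q)
    = ((q * A + p * B) * S + q * A * y N `^ (p + q)) / (p + q) by ring.
rewrite (mulrAC (q * C)) ler_pM2r ?invr_gt0// (mulrDr (q * C)).
have pB0 : 0 <= p * B by rewrite mulr_ge0// ltW.
have AC : A <= C by lra.
have coef : q * A + p * B <= q * C.
  apply: (@le_trans _ _ (q * (A + p * B))); last by rewrite ler_pM2l.
  by rewrite mulrDr lerD2l ler_peMl.
by rewrite lerD// ler_wpM2r// ler_pM2l.
Qed.

(** * The quasi-norm of intervals *)

Lemma inorm_ge0 {R : realType} (u : cinterval R) : 0 <= inorm u.
Proof. by rewrite /inorm le_max normr_ge0. Qed.

Lemma inorm_ipoint0 {R : realType} : inorm (ipoint (0 : R)) = 0.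
Proof. by rewrite /inorm /= normr0 maxxx. Qed.

Lemma norm_le_inorm {R : realType} (u : cinterval R) (t : R) :
  iset u t -> `|t| <= inorm u.
Proof.
move=> /andP[ut tu]; rewrite /inorm le_max.
have [t0|/ltW t0] := leP 0 t.
  by rewrite (ger0_norm t0) (ger0_norm (le_trans t0 tu)) tu orbT.
by rewrite (ler0_norm t0) (ler0_norm (le_trans ut t0)) lerN2 ut.
Qed.

Lemma inorm_imul_le {R : realType} (u v : cinterval R) :
  inorm (imul u v) <= inorm u * inorm v.
Proof.
have le_prod x y : `|x| <= inorm u -> `|y| <= inorm v ->
    `|x * y| <= inorm u * inorm v.
  by move=> xu yv; rewrite normrM ler_pM.
have lou : `|lo u| <= inorm u by rewrite le_max lexx.
have hiu : `|hi u| <= inorm u by rewrite le_max lexx orbT.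
have lov : `|lo v| <= inorm v by rewrite le_max lexx.
have hiv : `|hi v| <= inorm v by rewrite le_max lexx orbT.
rewrite {1}/inorm /= ge_max; apply/andP; split.
  by rewrite /Num.min; do !case: ifP => _; exact: le_prod.
by rewrite /Num.max; do !case: ifP => _; exact: le_prod.
Qed.

(** Both conventions for the power, real exponent on a nonnegative base and
    natural exponent on any base, commute with the absolute value. *)
Lemma norm_rpow {R : realType} (u : cinterval R) (l t : R) :
  ipow_defined u l -> iset u t -> `|rpow t l| = `|t| `^ l.
Proof.
move=> [u0|[k [_ ->]]] ut; last by rewrite rpow_nat normrX powR_mulrn.
have t0 : 0 <= t := u0 _ ut.
by rewrite /rpow t0 norm_powR.
Qed.

Lemma inorm_ipow_le {R : realType} (u : cinterval R) (l : R) : 1 <= l ->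
  ipow_defined u l -> inorm (ipow u l) <= inorm u `^ l.
Proof.
move=> l1 ud.
have le_pow s : iset (ipow u l) s -> `|s| <= inorm u `^ l.
  rewrite iset_ipow// => -[t ut <-]; rewrite (norm_rpow _ _ _ ud ut).
  apply: ge0_ler_powR; rewrite ?nnegrE ?inorm_ge0 ?norm_le_inorm//.
  exact: le_trans l1.
by rewrite {1}/inorm ge_max !le_pow// /iset /= lexx lo_le_hi.
Qed.

(** The gH-difference sorts the two endpoint differences, and a maximum does not
    see their order. *)
Lemma inorm_igHsub {R : realType} (u v : cinterval R) :
  inorm (igHsub u v) = Num.max `|lo u - lo v| `|hi u - hi v|.
Proof. by rewrite /inorm /=; case: (leP (lo u - lo v)) => _ //; rewrite maxC. Qed.

Lemma inorm_le_igHsub {R : realType} (u v : cinterval R) :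
  inorm v <= inorm u + inorm (igHsub u v).
Proof.
have tri (x y : R) : `|y| <= `|x| + `|x - y|.
  by have := ler_normB x (x - y); rewrite opprB addrC subrK.
rewrite inorm_igHsub {1}/inorm ge_max; apply/andP; split.
  by apply: (le_trans (tri (lo u) _)); rewrite lerD// le_max lexx.
by apply: (le_trans (tri (hi u) _)); rewrite lerD// le_max lexx orbT.
Qed.

(** * The Opial inequality for intervals *)

Theorem theorem3p11 (R : realType) (n m : nat) (u : nat -> cinterval R)
    (l1 l2 : R)
    (n_ge1 : (1 <= n)%N) (n_le_m : (n <= m)%N)
    (um0 : u m = ipoint 0)
    (l1_ge1 : 1 <= l1) (l2_ge1 : 1 <= l2)
    (pow_def : forall i, (n <= i < m)%N ->
       ipow_defined (u i) l1 /\ ipow_defined (nabla u i) l2)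
    (u_mono : piecewise_alternate_monotone u 0 m)
    (u_mu_mono : piecewise_alternate_mu_monotone u 0 m)
    (u_neq0 : forall i, (n <= i < m)%N -> u i <> ipoint 0) :
  \sum_(n <= i < m) inorm (imul (ipow (u i) l1) (ipow (nabla u i) l2))
    <= (l2 * (m - n + 1)%:R `^ l1) / (l1 + l2)
       * \sum_(n <= i < m.+1) inorm (nabla u i) `^ (l1 + l2).
Proof.
pose a i := inorm (u i); pose d i := inorm (nabla u i).
apply: (@le_trans _ _ (\sum_(n <= i < m.+1) a i `^ l1 * d i `^ l2)).
  rewrite [leRHS]big_nat_recr//= -[leLHS]addr0 lerD//; last first.
    by rewrite mulr_ge0 ?powR_ge0.
  rewrite big_nat [leRHS]big_nat; apply: ler_sum => i /pow_def[ud nd].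
  apply: (le_trans (inorm_imul_le _ _)).
  by apply: ler_pM; rewrite ?inorm_ge0 ?inorm_ipow_le.
(* Counting down from [m] makes the partial sums start at [u m = 0]. *)
have reindex (F : nat -> R) :
    \sum_(n <= i < m.+1) F i = \sum_(k < m - n + 1) F (m - k)%N.
  rewrite big_nat_rev /= -{1}[n]add0n big_addn subSn// addn1 big_mkord.
  apply: eq_bigr => k _; congr F.
  by rewrite addnS subSS addnC subnDr.
rewrite !reindex.
apply: (@discrete_opial R _ (fun k => a (m - k)%N) (fun k => d (m - k)%N)) => //.
- by move=> k; exact: inorm_ge0.
- by move=> k; exact: inorm_ge0.
- elim=> [|k IH] kN; first by rewrite subn0 big_ord0 /a um0 inorm_ipoint0.
  rewrite big_ord_recr /=.
  apply: (@le_trans _ _ (a (m - k)%N + d (m - k)%N)).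
    by rewrite /a /d /nabla subnS; exact: inorm_le_igHsub.
  by rewrite lerD2r IH// ltnW.
Qed.
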